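(* Let $1\le r\le N$ be integers and put $L=N-r+1$. The maximal-minor map $$\Psi:\bigwedge^LE\longrightarrow H^0(\mathbb P(S_r),\mathcal O(L))=\mathbb Z[A_0,\dots,A_r]_L$$ is an isomorphism of free $\mathbb Z$-modules. Consequently it is an isomorphism after base change to every ring.
   Context: $S_n=H^0(\mathbb P^1_{\mathbb Z},\mathcal O(n))$ is the free $\mathbb Z$-module of binary forms of degree $n$ with basis $X^iZ^{n-i}$, $0\le i\le n$, and $E=S_N^*$ with dual basis $\varepsilon_0,\dots,\varepsilon_N$. $\mathbb P(S_r)$ is the projective space of lines of binary forms of degree $r$, with homogeneous coordinates $A_0,\dots,A_r$ (so $G=\sum_{k=0}^rA_kX^kZ^{r-k}$), and $\mathbb Z[A_0,\dots,A_r]_L$ is the module of homogeneous polynomials of degree $L$ in the $A_k$. Let $M(G)=(A_{i-j})_{0\le i\le N,\,0\le j<L}$ with $A_k=0$ for $k\notin[0,r]$. The map $\Psi$ is the $\mathbb Z$-linear map sending $\varepsilon_{i_0}\wedge\dots\wedge\varepsilon_{i_{L-1}}$, for $0\le i_0<\dots<i_{L-1}\le N$, to the $L\times L$ minor of $M(G)$ on rows $i_0,\dots,i_{L-1}$ (and all $L$ columns). *)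

(* Defs.v *)
(* Classical logic is used only to turn the membership in a generated
   subgroup into a boolean predicate, as the quotient construction requires. *)
From HB Require Import structures.
From mathcomp Require Import all_boot all_order all_algebra.
From mathcomp Require Import boolp.
From mathcomp Require Import freeg mpoly.

Set Implicit Arguments.
Unset Strict Implicit.
Unset Printing Implicit Defensive.

Import GRing.Theory.
Local Open Scope ring_scope.
Local Open Scope quotient_scope.

(* Z-modules are [zmodType]s and Z-linear maps are additive maps. *)

Section Presented.
Variables (K : choiceType) (rel : {freeg K / int} -> Prop).

Definition gen_subgroup (x : {freeg K / int}) : bool :=
  `[< forall S : {freeg K / int} -> Prop,
        S 0 -> (forall y z, S y -> S z -> S (y - z)) ->
        (forall y, rel y -> S y) -> S x >].

Lemma gen_subgroup_closed : zmod_closed gen_subgroup.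
Proof.
split; first by apply/asboolP.
move=> x y /asboolP Hx /asboolP Hy; apply/asboolP => S S0 SB Sr.
by apply: (SB); [apply: Hx | apply: Hy].
Qed.

HB.instance Definition _ :=
  GRing.isZmodClosed.Build {freeg K / int} gen_subgroup gen_subgroup_closed.

Lemma rel_gen_subgroup x : rel x -> x \in gen_subgroup.
Proof. by move=> rx; apply/asboolP => S _ _; apply. Qed.

(* The abelian group with generators K and relators rel. *)
Definition presented :=
  Quotient.quot (GRing.ZmodClosed.clone _ gen_subgroup _).
HB.instance Definition _ := GRing.Zmodule.on presented.
HB.instance Definition _ : EqQuotient {freeg K / int} _ presented := EqQuotient.on presented.

Definition pres_pi (x : {freeg K / int}) : presented := \pi_presented x.
Definition pgen (k : K) : presented := pres_pi << k >>.

Lemma pres_pi_additive : zmod_morphism pres_pi.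
Proof. exact: pi_is_zmod_morphism. Qed.

HB.instance Definition _ :=
  GRing.isZmodMorphism.Build {freeg K / int} presented pres_pi pres_pi_additive.

Lemma pres_pi_surj (u : presented) : exists x, u = pres_pi x.
Proof.
exists (repr u).
by rewrite /pres_pi reprK.
Qed.

Lemma pres_pi_eq0 x : (pres_pi x == 0) = (x \in gen_subgroup).
Proof.
have -> : 0 = pres_pi 0 by rewrite raddf0.
by rewrite -[X in X \in _]subr0 Quotient.idealrBE.
Qed.

Lemma presented_ind (P : presented -> Prop) :
  P 0 -> (forall u v, P u -> P v -> P (u - v)) -> (forall k, P (pgen k)) ->
  forall u, P u.
Proof.
move=> P0 PB Pg u; have [x ->] := pres_pi_surj u.
have PN v : P v -> P (- v) by move=> Pv; rewrite -sub0r; apply: PB.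
have PD v w : P v -> P w -> P (v + w).
  by move=> Pv Pw; rewrite -[w]opprK; apply: PB => //; apply: PN.
rewrite -[x]freeg_sumE raddf_sum /=.
elim/big_ind: _ => // k _; move: (coeff k x) => c.
have -> : pres_pi << c *g k >> = pgen k *~ c.
  by rewrite /pgen -raddfMz freegU_mulz intz.
case: c => n; [|rewrite NegzE mulrNz; apply: (PN)]; rewrite -pmulrn.
  by elim: n => [|n IH]; rewrite ?mulr0n // mulrS; apply: PD.
by elim: n.+1 => [|m IH]; rewrite ?mulr0n // mulrS; apply: PD.
Qed.

Variables (A : zmodType) (f : K -> A).

(* [zmodule A] is A viewed as a left int-module. *)
Definition fext : {freeg K / int} -> A := fglift (f : K -> zmodule A).

Lemma fext_additive : zmod_morphism fext.
Proof. exact: (@lift_is_additive int K (zmodule A) f). Qed.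

HB.instance Definition _ :=
  GRing.isZmodMorphism.Build {freeg K / int} A fext fext_additive.

Lemma fextU k : fext << k >> = f k.
Proof. by rewrite /fext liftU scale1r. Qed.

Definition pres_lift_fun (_ : forall x, rel x -> fext x = 0) (u : presented) : A :=
  fext (repr u).

Hypothesis fP : forall x, rel x -> fext x = 0.

Lemma fext_gen_subgroup x : x \in gen_subgroup -> fext x = 0.
Proof.
move/asboolP => /(_ (fun x => fext x = 0)); apply=> //; first exact: raddf0.
by move=> y z y0 z0; rewrite raddfB /= y0 z0 subrr.
Qed.

Lemma pres_lift_pi x : pres_lift_fun fP (pres_pi x) = fext x.
Proof.
apply/eqP; rewrite -subr_eq0 -raddfB; apply/eqP/fext_gen_subgroup.
by rewrite Quotient.idealrBE reprK.
Qed.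

Lemma pres_lift_additive : zmod_morphism (pres_lift_fun fP).
Proof.
move=> u v; have [x ->] := pres_pi_surj u; have [y ->] := pres_pi_surj v.
by rewrite -raddfB !pres_lift_pi raddfB.
Qed.

HB.instance Definition _ :=
  GRing.isZmodMorphism.Build presented A (pres_lift_fun fP) pres_lift_additive.

Definition pres_lift : {additive presented -> A} := pres_lift_fun fP.

Lemma pres_liftE k : pres_lift (pgen k) = f k.
Proof. by rewrite /pres_lift /= pres_lift_pi fextU. Qed.

End Presented.

Section ExteriorPower.
Variables (L : nat) (M : zmodType).

Definition upd (v : {ffun 'I_L -> M}) (i : 'I_L) (x : M) : {ffun 'I_L -> M} :=
  [ffun j => if j == i then x else v j].

(* Over Z, additivity in each argument is multilinearity. *)
Inductive ext_rel : {freeg {ffun 'I_L -> M} / int} -> Prop :=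
| ext_rel_add (v : {ffun 'I_L -> M}) i x y :
    ext_rel (<< upd v i (x + y) >> - << upd v i x >> - << upd v i y >>)
| ext_rel_alt (v : {ffun 'I_L -> M}) i j : i != j -> v i = v j -> ext_rel << v >>.

Definition ext_power := presented ext_rel.
HB.instance Definition _ := GRing.Zmodule.on ext_power.

(* v 0 /\ v 1 /\ ... /\ v (L - 1) *)
Definition wedge (v : 'I_L -> M) : ext_power := pgen ext_rel (finfun v).

End ExteriorPower.

Section BaseChange.
Variables (R : pzRingType) (M : zmodType).

Inductive tensor_rel : {freeg (R * M)%type / int} -> Prop :=
| tensor_rel_addl a b m :
    tensor_rel (<< (a + b, m) >> - << (a, m) >> - << (b, m) >>)
| tensor_rel_addr a m n :
    tensor_rel (<< (a, m + n) >> - << (a, m) >> - << (a, n) >>).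

(* The tensor product of R and M over Z, with its left R-module structure. *)
Definition base_change := presented tensor_rel.
HB.instance Definition _ := GRing.Zmodule.on base_change.

Definition tens (a : R) (m : M) : base_change := pgen tensor_rel (a, m).

Lemma pgen_tens am : pgen tensor_rel am = tens am.1 am.2.
Proof. by case: am. Qed.

Lemma tensDl a b m : tens (a + b) m = tens a m + tens b m.
Proof.
apply/eqP; rewrite -subr_eq0 opprD addrA /tens /pgen -!raddfB pres_pi_eq0.
exact/rel_gen_subgroup/tensor_rel_addl.
Qed.

Lemma tensDr a m n : tens a (m + n) = tens a m + tens a n.
Proof.
apply/eqP; rewrite -subr_eq0 opprD addrA /tens /pgen -!raddfB pres_pi_eq0.
exact/rel_gen_subgroup/tensor_rel_addr.
Qed.

Lemma tensor_lift_compat (A : zmodType) (f : R * M -> A) :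
  (forall a b m, f (a + b, m) = f (a, m) + f (b, m)) ->
  (forall a m n, f (a, m + n) = f (a, m) + f (a, n)) ->
  forall x, tensor_rel x -> fext f x = 0.
Proof.
by move=> fl fr _ [a b m|a m n]; rewrite !raddfB /= !fextU (fl, fr) -addrA -opprD subrr.
Qed.

Lemma tens_scale_compat (a : R) x :
  tensor_rel x -> fext (fun bm : R * M => tens (a * bm.1) bm.2) x = 0.
Proof.
move: x; apply: tensor_lift_compat => *; first by rewrite mulrDr tensDl.
exact: tensDr.
Qed.

Definition tens_scale (a : R) : {additive base_change -> base_change} :=
  pres_lift (@tens_scale_compat a).

Lemma tens_scaleE a b m : tens_scale a (tens b m) = tens (a * b) m.
Proof. exact: pres_liftE. Qed.

Lemma base_change_ind (P : base_change -> Prop) :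
  P 0 -> (forall u v, P u -> P v -> P (u - v)) -> (forall a m, P (tens a m)) ->
  forall u, P u.
Proof. by move=> P0 PB Pt; apply: presented_ind => // -[]. Qed.

Lemma tens_scaleA a b u : tens_scale a (tens_scale b u) = tens_scale (a * b) u.
Proof.
elim/base_change_ind: u => [|u v IHu IHv|c m]; first by rewrite !raddf0.
  by rewrite !raddfB /= IHu IHv.
by rewrite !tens_scaleE mulrA.
Qed.

Lemma tens_scale1 : left_id 1 tens_scale.
Proof.
move=> u; elim/base_change_ind: u => [|u v IHu IHv|c m]; first by rewrite raddf0.
  by rewrite raddfB /= IHu IHv.
by rewrite tens_scaleE mul1r.
Qed.

Lemma tens_scaleDr : right_distributive tens_scale +%R.
Proof. by move=> a u v; rewrite raddfD. Qed.

Lemma tens_scaleDl u : {morph tens_scale^~ u : a b / a + b}.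
Proof.
move=> a b; elim/base_change_ind: u => [|u v IHu IHv|c m].
- by rewrite !raddf0 addr0.
- by rewrite !raddfB /= IHu IHv opprD addrACA.
by rewrite !tens_scaleE mulrDl tensDl.
Qed.

HB.instance Definition _ := GRing.Zmodule_isLmodule.Build R base_change
  tens_scaleA tens_scale1 tens_scaleDr tens_scaleDl.

Lemma scale_tens (a b : R) m : a *: tens b m = tens (a * b) m.
Proof. exact: tens_scaleE. Qed.

End BaseChange.

Section BaseChangeMap.
Variables (R : pzRingType) (M N : zmodType) (f : {additive M -> N}).

Lemma base_change_map_compat x :
  tensor_rel x -> fext (fun am : R * M => tens am.1 (f am.2)) x = 0.
Proof.
move: x; apply: tensor_lift_compat => *; first exact: tensDl.
by rewrite raddfD tensDr.
Qed.

(* R (x) f *)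
Definition base_change_map : base_change R M -> base_change R N :=
  pres_lift base_change_map_compat.

Lemma base_change_mapE a m : base_change_map (tens a m) = tens a (f m).
Proof. exact: pres_liftE. Qed.

Lemma base_change_map_additive : zmod_morphism base_change_map.
Proof. exact: raddfB. Qed.

HB.instance Definition _ := GRing.isZmodMorphism.Build
  (base_change R M) (base_change R N) base_change_map base_change_map_additive.

Lemma base_change_map_scalable : scalable base_change_map.
Proof.
move=> a u; elim/base_change_ind: u => [|x y IHx IHy|c m].
- by rewrite scaler0 raddf0 scaler0.
- by rewrite scalerBr !base_change_map_additive IHx IHy scalerBr.
by rewrite scale_tens !base_change_mapE scale_tens.
Qed.

HB.instance Definition _ := GRing.isScalable.Build R
  (base_change R M) (base_change R N) _ base_change_map base_change_map_scalable.

End BaseChangeMap.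

Arguments base_change_map R [M N] f.

Definition free_of_finite_rank (M : zmodType) : Prop :=
  exists (n : nat) (e : 'I_n -> M),
    bijective (fun c : {ffun 'I_n -> int} => \sum_i e i *~ c i).

(* Binary forms: variable 0 of {mpoly int[2]} is X and variable 1 is Z. *)
Notation binary_forms n := (dhomog 2 int n).

Section DualBasis.
Variable n : nat.

Definition XZ_mnm (i : 'I_n.+1) : 'X_{1..2} := [multinom [tuple (i : nat); (n - i)%N]].

Lemma XZ_homog i : ('X_[XZ_mnm i] : {mpoly int[2]}) \is n.-homog.
Proof.
rewrite dhomogX /= mdegE !big_ord_recl big_ord0 !multinomE !(tnth_nth 0%N) /=.
by rewrite addn0 subnKC // -ltnS.
Qed.

Definition XZ_form (i : 'I_n.+1) : binary_forms n := DHomog (XZ_homog i).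

Definition dual_forms := 'Hom(binary_forms n, int^o).

Definition XZ_coeff (i : 'I_n.+1) (G : binary_forms n) : int^o :=
  (G : {mpoly int[2]})@_(XZ_mnm i).

Lemma XZ_coeff_linear i : linear (XZ_coeff i).
Proof. by move=> a G H; rewrite /XZ_coeff /= mcoeffD mcoeffZ. Qed.

HB.instance Definition _ i := GRing.isLinear.Build int
  (binary_forms n) int^o _ (XZ_coeff i) (XZ_coeff_linear i).

Definition eps (i : 'I_n.+1) : dual_forms := linfun (XZ_coeff i).

Lemma eps_dual i j : eps i (XZ_form j) = (i == j)%:R.
Proof.
rewrite lfunE /= /XZ_coeff /= mcoeffX; congr (nat_of_bool _)%:R.
apply/eqP/eqP => [|-> //] /mnmP /(_ ord0).
by rewrite !multinomE !(tnth_nth 0%N) /= => ij; apply/val_inj.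
Qed.

End DualBasis.

(* A_k, which is 0 for k outside [0, r]. *)
Definition coefA (r : nat) (k : int) : {mpoly int[r.+1]} :=
  if k is Posz m then (if (m <= r)%N then 'X_(inord m) else 0) else 0.

Definition coef_matrix (N r L : nat) : 'M[{mpoly int[r.+1]}]_(N.+1, L) :=
  \matrix_(i, j) coefA r ((i : nat)%:Z - (j : nat)%:Z).

(* [dhomog r.+1 int L] is Z[A_0, ..., A_r]_L. *)
Definition is_maximal_minor_map (N r L : nat)
    (Psi : {additive ext_power L (dual_forms N) -> dhomog r.+1 int L}) : Prop :=
  forall i : 'I_L -> 'I_N.+1, {homo i : a b / (a < b)%N} ->
    Psi (wedge (fun a => eps (i a))) = \det (rowsub i (coef_matrix N r L))
      :> {mpoly int[r.+1]}.

(* Main.v *)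
(* Give A_k the weight k^2. By the rearrangement inequality, among the terms
   of the Leibniz expansion of det (A_{i_a - b}) the diagonal one has strictly
   the least weight. So, with respect to the weight, the minors are
   unitriangular over the monomials of degree L, where the minor on rows
   i_0 < ... < i_{L-1} corresponds to the product of the A_{i_a - a}; hence
   they form a Z-basis. Since the increasing wedges of the eps_i generate the
   exterior power and are sent to this basis, they form a basis too and Psi is
   an isomorphism; an additive bijection stays bijective after base change. *)
Require Import Defs.
From HB Require Import structures.
From mathcomp Require Import all_boot all_order all_algebra all_fingroup.
From mathcomp Require Import freeg mpoly.
From mathcomp Require Import zify.

Set Implicit Arguments.
Unset Strict Implicit.
Unset Printing Implicit Defensive.

Import GRing.Theory.
Local Open Scope ring_scope.

(** * Increasing maps and the rearrangement inequality *)

Lemma increasing_gap (n m : nat) (f : 'I_n -> 'I_m) :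
  {homo f : a b / (a < b)%N} ->
  forall a b : 'I_n, (a <= b)%N -> (f a + (b - a) <= f b)%N.
Proof.
move=> f_incr a b; move Dd: (b - a)%N => d le_ab.
have {le_ab Dd}: (b = a + d :> nat)%N by rewrite -Dd subnKC.
elim: d b => [|d IHd] b Db; first by rewrite addn0 (_ : b = a) //; apply/val_inj; rewrite /= Db addn0.
have lt_n : (a + d < n)%N by have := ltn_ord b; lia.
have := IHd (Ordinal lt_n) erefl.
have := f_incr (Ordinal lt_n) b; rewrite /= Db; lia.
Qed.

(** Compare [f a] with the values at the first and last index. For row indices, where [n = L] and
    [m = N + 1], this puts i_a - a in [0, r], so the diagonal entries of a minor are genuine
    variables. *)
Lemma increasing_bounds (n m : nat) (f : 'I_n -> 'I_m) :
  {homo f : a b / (a < b)%N} ->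
  forall a : 'I_n, (a <= f a)%N && (f a + n <= m + a)%N.
Proof.
move=> f_incr a; case: n => [|n] in f f_incr a *; first by case: a.
have := increasing_gap f_incr (leq0n a : (ord0 <= a)%N).
have := increasing_gap f_incr (leq_ord a : (a <= ord_max)%N).
by have := ltn_ord (f ord_max); have := leq_ord a; move=> /= *; lia.
Qed.

Lemma increasing_perm_id (n : nat) (s : 'S_n) :
  {homo s : a b / (a < b)%N} -> s = 1%g.
Proof.
move=> s_incr; apply/permP => a; rewrite perm1; apply/val_inj.
by have /andP[] := increasing_bounds s_incr a => /=; lia.
Qed.

(** Undoing an inversion strictly increases the sum, so a maximizing permutation has no inversion
    and is the identity; any other permutation is strictly below some sum, hence below the
    maximum. *)
Lemma rearrangement (n : nat) (f : 'I_n -> nat) (s : 'S_n) :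
  {homo f : a b / (a < b)%N} -> s != 1%g ->
  (\sum_a f a * s a < \sum_a f a * a)%N.
Proof.
move=> f_incr s_neq1.
pose F (u : 'S_n) := (\sum_a f a * u a)%N.
have F_swap (u : 'S_n) : u != 1%g -> exists u' : 'S_n, (F u < F u')%N.
  move=> u_neq1.
  have [a [b [lt_ab lt_u]]] : exists a b : 'I_n, (a < b)%N /\ (u b < u a)%N.
    case: (boolP [exists a : 'I_n, [exists b : 'I_n, (a < b)%N && (u b < u a)%N]]).
      by move=> /existsP[a /existsP[b /andP[? ?]]]; exists a, b.
    move=> no_inv; case/eqP: u_neq1; apply: increasing_perm_id => a b lt_ab.
    move: no_inv; rewrite negb_exists => /forallP/(_ a).
    rewrite negb_exists => /forallP/(_ b); rewrite lt_ab /= -leqNgt.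
    rewrite leq_eqVlt => /orP[/eqP/val_inj/perm_inj eq_ab|//].
    by rewrite eq_ab ltnn in lt_ab.
  have neq_ba : b != a by apply: contraTneq lt_ab => ->; rewrite ltnn.
  (* Only the terms at a and b change, and the gain is (f b - f a)(u a - u b) > 0. Below, both
     factors are written as successors so that [lia] sees linear inequalities in the products. *)
  exists (tperm a b * u)%g; rewrite /F (bigD1 a) //= (bigD1 b) //=.
  rewrite [ltnRHS](bigD1 a) //= [in ltnRHS](bigD1 b) //=.
  rewrite [in ltnRHS](eq_bigr (fun c => f c * u c)%N); last first.
    by move=> c /andP[c_a c_b]; rewrite permM tpermD // eq_sym.
  rewrite !permM tpermL tpermR !addnA ltn_add2r.
  have := f_incr _ _ lt_ab; move: (f a) (f b) (u a : nat) (u b : nat) lt_u.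
  move=> p q y x /subnKC <- /subnKC <-; move: (y - x.+1)%N (q - p.+1)%N => k l.
  rewrite !(mulnDl, mulnDr, mulnS, mulSn); lia.
have [v _ v_max] := arg_maxnP F (erefl : predT (1%g : 'S_n)).
have v1 : v = 1%g.
  by apply: contraTeq isT => /F_swap[u' lt_F]; have := v_max u' isT; rewrite /= leqNgt lt_F.
have [u' lt_F] := F_swap _ s_neq1.
rewrite [ltnRHS](eq_bigr (fun a => f a * (1%g : 'S_n) a)%N) => [|a _]; last by rewrite perm1.
by apply: leq_trans lt_F _; rewrite -v1; apply: v_max.
Qed.

(** Expanding the squares, the displacement plus twice the sum of the f a * u a is independent of u,
    so least displacement means greatest sum of products. *)
Lemma displacement_minimal (n : nat) (f : 'I_n -> nat) (s : 'S_n) :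
  {homo f : a b / (a < b)%N} -> s != 1%g ->
  (\sum_a `|(f a)%:Z - ((1%g : 'S_n) a : nat)%:Z| ^ 2
    < \sum_a `|(f a)%:Z - (s a : nat)%:Z| ^ 2)%N.
Proof.
move=> f_incr s_neq1.
have sum_sq (u : 'S_n) : (\sum_a `|(f a)%:Z - (u a : nat)%:Z| ^ 2
    + 2 * \sum_a f a * u a = \sum_a f a ^ 2 + \sum_(a < n) a ^ 2)%N.
  have -> : (\sum_(a < n) a ^ 2 = \sum_a (u a) ^ 2)%N by exact: reindex_inj perm_inj.
  rewrite big_distrr -!big_split; apply: eq_bigr => a _ /=.
  exact: IntDist.sqrn_dist.
have := sum_sq 1%g.
rewrite [X in (2 * X)%N](eq_bigr (fun a => f a * a)%N) => [|a _]; last by rewrite perm1.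
move=> sum_sq1; rewrite -(ltn_add2r (2 * \sum_a f a * a)%N) sum_sq1 -(sum_sq s).
by rewrite ltn_add2l ltn_pmul2l // rearrangement.
Qed.

(** * The weight of A_k is k^2; homogeneity of determinants *)

Section SquareWeight.
Variable n : nat.

Definition sqwgt (m : 'X_{1..n}) : nat := (\sum_i m i * i ^ 2)%N.

Lemma sqwgt0 : sqwgt 0%MM = 0%N.
Proof. by rewrite /sqwgt big1 // => i _; rewrite mnm0E. Qed.

Lemma sqwgtD : {morph sqwgt : m1 m2 / (m1 + m2)%MM >-> (m1 + m2)%N}.
Proof.
move=> m1 m2; rewrite /sqwgt -big_split; apply: eq_bigr => i _.
by rewrite mnmDE mulnDl.
Qed.

HB.instance Definition _ := isMeasure.Build n sqwgt sqwgt0 sqwgtD.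

Lemma sqwgt1 i : sqwgt U_(i)%MM = (i ^ 2)%N.
Proof.
rewrite /sqwgt (bigD1 i) //= mnm1E eqxx mul1n big1 ?addn0 // => j j_i.
by rewrite mnm1E eq_sym (negbTE j_i).
Qed.

End SquareWeight.

Lemma homog_bigprod (I : finType) (n : nat) (R : comNzRingType) (mf : measure n)
    (F : I -> {mpoly R[n]}) (d : I -> nat) :
  (forall i, F i \is (d i).-homog for mf) ->
  \prod_i F i \is (\sum_i d i)%N.-homog for mf.
Proof.
move=> Fd; elim/big_rec2: _ => [|i e p _ IH]; first exact: dhomog1.
exact: dhomogM.
Qed.

Lemma homog_det (k n d : nat) (R : comNzRingType) (A : 'M[{mpoly R[n]}]_k) :
  (forall i j, A i j \is d.-homog) -> \det A \is (k * d)%N.-homog.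
Proof.
move=> Ad; apply: rpred_sum => s _; rewrite mulr_sign.
have : \prod_i A i (s i) \is (k * d)%N.-homog.
  have := homog_bigprod (mf := mdeg) (fun i => Ad i (s i)).
  by rewrite sum_nat_const card_ord.
by case: ifP => _; rewrite ?rpredN.
Qed.

Lemma coefA_homog (r : nat) (k : int) : coefA r k \is 1%N.-homog.
Proof.
case: k => [k|k] /=; last exact: rpred0.
by case: leqP => _; [rewrite dhomogX /= mdeg1 | exact: rpred0].
Qed.

(** For k outside [0, r] the entry is 0, which is homogeneous of every weight. *)
Lemma coefA_sqwgt (r : nat) (k : int) : coefA r k \is (`|k| ^ 2)%N.-homog for @sqwgt _.
Proof.
case: k => [k|k] /=; last exact: rpred0.
case: leqP => k_r; last exact: rpred0.
by rewrite dhomogX /= sqwgt1 inordK.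
Qed.

(** * Integer combinations, bases and base change of bijections *)

Definition int_comb (T : finType) (M : zmodType) (e : T -> M) (c : {ffun T -> int}) : M :=
  \sum_t e t *~ c t.

Lemma int_comb_is_additive (T : finType) (M : zmodType) (e : T -> M) :
  zmod_morphism (int_comb e).
Proof.
by move=> c d; rewrite /int_comb -sumrB; apply: eq_bigr => t _; rewrite !ffunE mulrzBr.
Qed.

HB.instance Definition _ (T : finType) (M : zmodType) (e : T -> M) :=
  GRing.isZmodMorphism.Build {ffun T -> int} M (int_comb e) (int_comb_is_additive e).

Lemma int_comb_delta (T : finType) (M : zmodType) (e : T -> M) t :
  int_comb e [ffun u => (u == t)%:R] = e t.
Proof.
rewrite /int_comb (bigD1 t) //= ffunE eqxx big1 ?addr0 // => u u_t.
by rewrite ffunE (negbTE u_t).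
Qed.

Lemma raddf_int_comb (T : finType) (M M' : zmodType) (f : {additive M -> M'})
    (e : T -> M) c :
  f (int_comb e c) = int_comb (f \o e) c.
Proof. by rewrite raddf_sum; apply: eq_bigr => t _; rewrite raddfMz. Qed.

Lemma bijectiveP (A : choiceType) (B : eqType) (f : A -> B) :
  injective f -> (forall y, exists x, f x = y) -> bijective f.
Proof.
move=> f_inj f_surj.
have ex y : exists x, f x == y by have [x <-] := f_surj y; exists x.
have fK y : f (xchoose (ex y)) = y by apply/eqP/(xchooseP (ex y)).
by exists (fun y => xchoose (ex y)) => // x; apply: f_inj; rewrite fK.
Qed.

(** The bases below are indexed by monomials; enumerating the index type passes to ['I_n]. *)
Lemma free_of_int_comb (T : finType) (M : zmodType) (e : T -> M) :
  bijective (int_comb e) -> free_of_finite_rank M.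
Proof.
move=> e_bij; exists #|T|, (e \o enum_val).
pose g (c : {ffun 'I_#|T| -> int}) := [ffun t => c (enum_rank t)].
have g_bij : bijective g.
  exists (fun c : {ffun T -> int} => [ffun i => c (enum_val i)]) => c; apply/ffunP => x.
    by rewrite !ffunE enum_valK.
  by rewrite !ffunE enum_rankK.
apply: (eq_bij (bij_comp e_bij g_bij)) => c.
rewrite /int_comb /= (reindex (@enum_val T predT)) /=.
  by apply: eq_bigr => i _; rewrite ffunE enum_valK.
exact: onW_bij (enum_val_bij T).
Qed.

(** The inverse of f is additive, so it has a base change too; the two composites are the identity
    on pure tensors, which generate. *)
Lemma base_change_map_bij (R : pzRingType) (M N : zmodType) (f : {additive M -> N}) :
  bijective f -> bijective (base_change_map R f).
Proof.
case=> g fK gK.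
have g_add : zmod_morphism g.
  by move=> x y; apply: (can_inj fK); rewrite raddfB !gK.
pose gA := HB.pack_for {additive N -> M} g (GRing.isZmodMorphism.Build N M g g_add).
exists (base_change_map R gA) => u; elim/base_change_ind: u => [|u v IHu IHv|a m].
- by rewrite !raddf0.
- by rewrite !raddfB /= IHu IHv.
- by rewrite !base_change_mapE /= fK.
- by rewrite !raddf0.
- by rewrite !raddfB /= IHu IHv.
by rewrite !base_change_mapE /= gK.
Qed.

(** * Families unitriangular over the monomials of degree L *)

Section Unitriangular.
Variables (n L : nat) (T : finType) (mu : T -> 'X_{1..n}) (w : 'X_{1..n} -> nat).
Variable psi : T -> dhomog n int L.
Hypothesis mu_inj : injective mu.
Hypothesis mu_surj : forall m, mdeg m = L -> exists t, mu t = m.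
Hypothesis psi_lead : forall t, (psi t : {mpoly int[n]})@_(mu t) = 1.
Hypothesis psi_above : forall t m,
  (psi t : {mpoly int[n]})@_m != 0 -> m = mu t \/ (w (mu t) < w m)%N.

Lemma mcoeff_int_comb c m :
  (int_comb psi c : {mpoly int[n]})@_m = \sum_t (psi t : {mpoly int[n]})@_m *~ c t.
Proof. by rewrite (raddf_int_comb (@mpoly_of_dhomog _ _ _)) (raddf_int_comb (mcoeff m)). Qed.

(** Among the t with [c t] nonzero take one of least weight: no other term of the combination
    reaches the monomial [mu t], whose coefficient is therefore [c t]. *)
Lemma unitriangular_inj : injective (int_comb psi).
Proof.
apply: raddf_inj => c c0; apply/ffunP => t0; rewrite ffunE; apply/eqP.
case: eqP => // /eqP ct0.
have [t ct t_min] := arg_minnP (fun t => w (mu t)) (ct0 : (fun t => c t != 0) t0).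
case/eqP: ct; have := mcoeff_int_comb c (mu t).
rewrite c0 mcoeff0 (bigD1 t) //= psi_lead intz => ->.
rewrite big1 ?addr0 // => u u_t.
have [->|cu] := eqVneq (c u) 0; first by rewrite mulr0z.
have [->|] := eqVneq ((psi u : {mpoly int[n]})@_(mu t)) 0; first by rewrite mul0rz.
case/psi_above => [/mu_inj tu|]; first by rewrite tu eqxx in u_t.
by rewrite ltnNge t_min.
Qed.

(** Every monomial of degree L is reached, by descending induction on its weight; these monomials
    span. *)
Lemma unitriangular_surj p : exists c, int_comb psi c = p.
Proof.
pose S q := exists c, (int_comb psi c : {mpoly int[n]}) = q.
have SB q q' : S q -> S q' -> S (q - q').
  by move=> [c <-] [c' <-]; exists (c - c'); rewrite raddfB.
have S0 : S 0 by exists 0; rewrite raddf0.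
have SN q : S q -> S (- q) by move=> /(SB _ _ S0); rewrite sub0r.
have SD q q' : S q -> S q' -> S (q + q').
  by move=> Sq /SN Sq'; rewrite -[q']opprK; apply: SB.
have SZ (a : int) q : S q -> S (a *: q).
  by move=> [c <-]; exists (c *~ a); rewrite -[in RHS](intz a) scaler_int -(raddfMz (@mpoly_of_dhomog _ _ _)) (raddfMz (int_comb psi)).
have SX : forall m, mdeg m = L -> S 'X_[m].
  (* By [mu_surj] this bounds the weight of every monomial of degree L, so [bound - w m] strictly
     drops as the weight rises. *)
  pose bound := (\max_t w (mu t))%N.
  move=> m; have [k] := ubnP (bound - w m)%N; elim: k m => // k IHk m le_k mL.
  have [t mu_t] := mu_surj mL.
  (* Solve the expansion of [psi t] for its leading monomial; all the other monomials are
     heavier. *)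
  have -> : 'X_[m] = (psi t : {mpoly int[n]})
      - \sum_(m' <- msupp (psi t) | m' != m) (psi t : {mpoly int[n]})@_m' *: 'X_[m'].
    have m_supp : m \in msupp (psi t) by rewrite mcoeff_msupp -mu_t psi_lead.
    rewrite [X in X - _]mpolyE (bigD1_seq m) ?msupp_uniq //=.
    by rewrite addrK -mu_t psi_lead scale1r.
  apply: SB; first by exists [ffun u => (u == t)%:R]; rewrite int_comb_delta.
  rewrite big_seq_cond; elim/big_ind: _ => // m' /andP[m'_supp m'_m].
  have m'L : mdeg m' = L by apply: (dhomogP _ _ _ (valP (psi t))).
  apply/SZ/IHk => //.
  have [u mu_u] := mu_surj m'L.
  have le_bound : (w m' <= bound)%N by rewrite -mu_u /bound (bigD1 u) //= leq_maxl.
  have [eq_m|] : m' = mu t \/ (w (mu t) < w m')%N.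
    by apply: psi_above; rewrite -mcoeff_msupp.
    by rewrite eq_m mu_t eqxx in m'_m.
  by rewrite mu_t; lia.
have [c c_p] : S p.
  rewrite [X in S X]mpolyE big_seq_cond; elim/big_ind: _ => // m /andP[m_supp _].
  by apply/SZ/SX; apply: (dhomogP _ _ _ (valP p)).
by exists c; apply/val_inj.
Qed.

Lemma unitriangular_bij : bijective (int_comb psi).
Proof. exact: bijectiveP unitriangular_inj unitriangular_surj. Qed.

End Unitriangular.

(** * Generation of the exterior power by increasing wedges *)

Lemma increasing_sort (n m : nat) (g : 'I_n -> 'I_m) :
  injective g -> exists s : 'S_n, {homo (fun a => g (s a)) : a b / (a < b)%N}.
Proof.
move=> g_inj; pose leI := [rel i j : 'I_m | (i <= j)%N]; pose t := [tuple g a | a < n].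
have leI_tr : transitive leI by move=> ? ? ?; apply: leq_trans.
have /tuple_permP[s Ds] : perm_eq (sort_tuple leI t) t by rewrite /= perm_sort.
have s_le (a b : 'I_n) : (a < b)%N -> (g (s a) <= g (s b))%N.
  have sorted_t : sorted leI (sort_tuple leI t) by apply: sort_sorted => ? ?; apply: leq_total.
  have sz : size (sort_tuple leI t) = n by rewrite size_tuple.
  have nthE (c : 'I_n) : nth (g a) (sort_tuple leI t) c = g (s c).
    by rewrite Ds -tnth_nth !tnth_mktuple.
  rewrite -!nthE => lt_ab; apply: (sorted_ltn_nth leI_tr _ sorted_t) => //;
    by rewrite inE sz.
(* Sorting yields weak inequalities; injectivity of g makes them strict. *)
exists s => a b lt_ab; rewrite ltn_neqAle s_le // andbT.
by apply: contraTneq lt_ab => /val_inj/g_inj/perm_inj ->; rewrite ltnn.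
Qed.

Section ExtPower.
Variables (L : nat) (M : zmodType).
Implicit Types (v : {ffun 'I_L -> M}) (x y : M).

Local Notation W := (pgen (@ext_rel L M)).

Lemma upd_id v i : upd v i (v i) = v.
Proof. by apply/ffunP => j; rewrite ffunE; case: eqP => [->|]. Qed.

Lemma updC v i j x y : i != j -> upd (upd v i x) j y = upd (upd v j y) i x.
Proof.
move=> i_j; apply/ffunP => k; rewrite !ffunE.
by case: eqP => // ->; rewrite eq_sym (negbTE i_j).
Qed.

Lemma pgen_updD v i x y : W (upd v i (x + y)) = W (upd v i x) + W (upd v i y).
Proof.
apply/eqP; rewrite -subr_eq0 opprD addrA /pgen -!raddfB pres_pi_eq0.
exact/rel_gen_subgroup/ext_rel_add.
Qed.

Definition wedge_at v i x : ext_power L M := W (upd v i x).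

Lemma wedge_at_additive v i : zmod_morphism (wedge_at v i).
Proof. by move=> x y; apply: (addIr (W (upd v i y))); rewrite /wedge_at -pgen_updD !subrK. Qed.

HB.instance Definition _ v i := GRing.isZmodMorphism.Build M (ext_power L M)
  (wedge_at v i) (wedge_at_additive v i).

Lemma pgen_alt v i j : i != j -> v i = v j -> W v = 0.
Proof.
move=> i_j v_ij; apply/eqP; rewrite /pgen pres_pi_eq0.
exact/rel_gen_subgroup/(ext_rel_alt i_j v_ij).
Qed.

(** Alternating implies antisymmetric: expand the wedge with v i + v j in both slots, which
    vanishes. *)
Lemma pgen_tperm v i j : i != j -> W [ffun a => v (tperm i j a)] = - W v.
Proof.
move=> i_j; pose W2 x y := W (upd (upd v i x) j y).
have W2_diag x : W2 x x = 0.
  by apply: (pgen_alt i_j); rewrite !ffunE eqxx (negbTE i_j) eqxx.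
have W2Dr x y z : W2 x (y + z) = W2 x y + W2 x z by apply: pgen_updD.
have W2Dl x y z : W2 (x + y) z = W2 x z + W2 y z.
  by rewrite /W2 !(updC _ _ _ i_j) pgen_updD.
have -> : W v = W2 (v i) (v j).
  by rewrite /W2 upd_id -[X in upd _ _ X]/(v j) upd_id.
have -> : [ffun a => v (tperm i j a)] = upd (upd v i (v j)) j (v i).
  apply/ffunP => a; rewrite !ffunE; case: tpermP => [->|->|].
  - by rewrite (negbTE i_j) eqxx.
  - by rewrite eqxx.
  by move=> /eqP/negbTE-> /eqP/negbTE->.
apply/eqP; rewrite -addr_eq0 -/(W2 _ _); apply/eqP.
by have := W2_diag (v i + v j); rewrite W2Dl !W2Dr !W2_diag add0r addr0 addrC.
Qed.

(** Multilinearity reduces to wedges of the e i; those with a repeated index vanish, and the others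
    are sorted at the cost of a sign. The form of an induction principle serves both generation and
    uniqueness of maps. *)
Lemma ext_power_basis_ind (n : nat) (e : 'I_n -> M) (P : ext_power L M -> Prop) :
  (forall x, exists c, int_comb e c = x) ->
  P 0 -> (forall u u', P u -> P u' -> P (u - u')) ->
  (forall f : 'I_L -> 'I_n, {homo f : a b / (a < b)%N} -> P (wedge (e \o f))) ->
  forall u, P u.
Proof.
move=> e_span P0 PB P_incr.
have PN u : P u -> P (- u) by move=> Pu; rewrite -sub0r; apply: PB.
have PD u u' : P u -> P u' -> P (u + u').
  by move=> Pu /PN Pu'; rewrite -[u']opprK; apply: PB.
have PZ u (c : int) : P u -> P (u *~ c).
  move=> Pu; have Pn k : P (u *+ k).
    by elim: k => [|k IHk]; rewrite ?mulr0n // mulrS; apply: PD.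
  by case: c => k; [rewrite -pmulrn | rewrite NegzE mulrNz -pmulrn; apply: PN].
(* Factor s into transpositions, each of which only changes the sign of the wedge. *)
have P_perm (s : 'S_L) v : P (W v) -> P (W [ffun a => v (s a)]).
  have [ts -> /allP] := prod_tpermP s; elim: ts v => [|[i j] ts IHts] v ts_neq Pv.
    by rewrite (_ : [ffun a => _] = v) //; apply/ffunP => a; rewrite ffunE big_nil perm1.
  have i_j : i != j by apply: (ts_neq (i, j)); rewrite mem_head.
  pose v' := [ffun a => v ((\prod_(t <- ts) tperm t.1 t.2)%g a)].
  have -> : [ffun a => v ((\prod_(t <- (i, j) :: ts) tperm t.1 t.2)%g a)]
      = [ffun a => v' (tperm i j a)].
    by apply/ffunP => a; rewrite !ffunE big_cons permM.
  rewrite pgen_tperm //; apply/PN/IHts => // t t_ts.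
  by apply: ts_neq; rewrite inE t_ts orbT.
have P_basis (g : 'I_L -> 'I_n) : P (W [ffun a => e (g a)]).
  case: (boolP (injectiveb g)) => [/injectiveP g_inj | /injectivePn[i [j i_j g_ij]]].
    have [s s_incr] := increasing_sort g_inj.
    have := P_perm s^-1%g _ (P_incr _ s_incr); congr (P (W _)).
    by apply/ffunP => a; rewrite !ffunE /= permKV.
  by rewrite (pgen_alt i_j) // !ffunE g_ij.
apply: presented_ind => // v.
(* Only the slots before k may still hold arbitrary vectors. The induction expands slot k over the
   spanning family; for k = L the condition is vacuous. *)
have {P_basis} P_part k : forall v, (forall a : 'I_L, (k <= a)%N -> exists i, v a = e i) -> P (W v).
  elim: k => [|k IHk] {}v v_e.
    have v_e' a : exists i, v a == e i by have [i ->] := v_e a (leq0n a); exists i.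
    have -> : v = [ffun a => e (xchoose (v_e' a))].
      by apply/ffunP => a; rewrite ffunE; apply/eqP/(xchooseP (v_e' a)).
    exact: P_basis.
  have [lt_kL|le_Lk] := ltnP k L; last first.
    by apply: IHk => a le_ka; have := ltn_ord a; lia.
  pose k' := Ordinal lt_kL; have [c Dc] := e_span (v k').
  rewrite -[v](upd_id _ k') -Dc -/(wedge_at v k' _) raddf_sum; elim/big_ind: _ => // i _.
  rewrite raddfMz; apply/PZ/IHk => a le_ka; rewrite ffunE.
  case: eqP => [_|/eqP a_k]; first by exists i.
  by apply: v_e; rewrite ltn_neqAle le_ka andbT eq_sym.
by apply: (P_part L) => a; rewrite leqNgt ltn_ord.
Qed.

End ExtPower.

(** * Binary forms, their dual, and monomials as sorted tuples *)

Lemma binary_monomial (n : nat) (m : 'X_{1..2}) :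
  mdeg m = n -> exists i : 'I_n.+1, m = XZ_mnm i.
Proof.
rewrite mdegE !big_ord_recl big_ord0 addn0 => <-.
have lt_m : (m ord0 < (m ord0 + m (fintype.lift ord0 ord0)).+1)%N by rewrite ltnS leq_addr.
exists (Ordinal lt_m); apply/mnmP => i; rewrite multinomE (tnth_nth 0%N) /=.
by case: i => -[|[|//]] lt_i /=; rewrite ?addKn; congr (m _); apply/val_inj.
Qed.

Lemma XZ_formE (n : nat) (G : binary_forms n) :
  G = \sum_(i < n.+1) XZ_coeff i G *: XZ_form i.
Proof.
apply/val_inj/mpolyP => m; rewrite /= raddf_sum raddf_sum /=.
have [mn|mn] := eqVneq (mdeg m) n; last first.
  rewrite (dhomog_nemf_coeff (valP G)) // big1 // => i _.
  rewrite mcoeffZ (dhomog_nemf_coeff (XZ_homog i)) ?mulr0 //.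
have [i ->] := binary_monomial mn.
rewrite (bigD1 i) //= mcoeffZ mcoeffX eqxx mulr1 big1 ?addr0 // => j j_i.
rewrite mcoeffZ mcoeffX; case: eqP => [/mnmP/(_ ord0)|]; last by rewrite mulr0.
by rewrite !multinomE !(tnth_nth 0%N) /= => /val_inj ij; rewrite ij eqxx in j_i.
Qed.

Lemma eps_span (n : nat) (phi : dual_forms n) : exists c, int_comb (@eps n) c = phi.
Proof.
exists [ffun i => phi (XZ_form i)]; apply/lfunP => G.
rewrite [in RHS](XZ_formE G) linear_sum sum_lfunE; apply: eq_bigr => i _.
by rewrite ffunE linearZ -scaler_int scale_lfunE lfunE /= intz; apply: mulrC.
Qed.

(** Weakly increasing d-tuples of variable indices encode the monomials of degree d; this gives
    pointwise access to their order. *)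
Lemma basisP (n d : nat) (u : d.-tuple 'I_n) :
  reflect {homo tnth u : a b / (a < b)%N >-> (a <= b)%N} (u \in basis n d).
Proof.
have nthE (a : 'I_d) : nth 0%N [seq val i | i <- u] a = tnth u a.
  by rewrite (nth_map (tnth u a)) ?size_tuple // -tnth_nth.
have sz_u : size [seq val i | i <- u] = d by rewrite size_map size_tuple.
rewrite inE; apply: (iffP idP) => [sorted_u a b lt_ab | u_homo].
  by rewrite -!nthE; apply: (sorted_ltn_nth leq_trans); rewrite // inE sz_u.
apply/(sortedP 0%N) => i; rewrite sz_u => lt_i.
by have := u_homo (Ordinal (ltnW lt_i)) (Ordinal lt_i) (ltnSn i); rewrite -!nthE.
Qed.

(** * Determinants as alternating multilinear functions of their rows *)

Section DetRows.
Variables (R : comNzRingType) (L : nat) (M : zmodType) (rowf : M -> 'rV[R]_L).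
Hypothesis rowfD : forall x y, rowf (x + y) = rowf x + rowf y.
Implicit Type v : {ffun 'I_L -> M}.

Definition rows_mx v : 'M[R]_L := \matrix_a rowf (v a).

Lemma det_rows_updD v i x y :
  \det (rows_mx (upd v i (x + y)))
    = \det (rows_mx (upd v i x)) + \det (rows_mx (upd v i y)).
Proof.
have eq_row' z z' : row' i (rows_mx (upd v i z)) = row' i (rows_mx (upd v i z')).
  apply/matrixP => a j; rewrite !mxE !ffunE.
  by have /negbTE-> : fintype.lift i a != i by rewrite eq_sym neq_lift.
rewrite (@determinant_multilinear _ _ _ (rows_mx (upd v i x)) (rows_mx (upd v i y)) i 1 1)
  ?mul1r //.
by rewrite !rowK !ffunE eqxx rowfD !scale1r.
Qed.

Lemma det_rows_alt v i j : i != j -> v i = v j -> \det (rows_mx v) = 0.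
Proof.
by move=> i_j v_ij; apply: (determinant_alternate i_j) => k; rewrite !mxE v_ij.
Qed.

End DetRows.

(** * The minor map, built by the universal property *)

Section MinorMap.
Variables N r L : nat.
Local Notation K := (coef_matrix N r L).

(** The linear extension of [eps i] |-> row i of the matrix. When r <= N and L = N - r + 1, entry j
    is [phi], with scalars extended, at X^j Z^(L-1-j) G. *)
Definition dual_row (phi : dual_forms N) : 'rV[{mpoly int[r.+1]}]_L :=
  (\row_i (phi (XZ_form i))%:MP) *m K.

Lemma dual_rowD phi phi' : dual_row (phi + phi') = dual_row phi + dual_row phi'.
Proof.
rewrite /dual_row -mulmxDl; congr (_ *m _); apply/rowP => i.
by rewrite !mxE add_lfunE mpolyCD.
Qed.

Lemma dual_rowE phi j :
  dual_row phi 0 j = \sum_i (phi (XZ_form i))%:MP * coefA r ((i : nat)%:Z - (j : nat)%:Z).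
Proof. by rewrite mxE; apply: eq_bigr => i _; rewrite !mxE. Qed.

Lemma dual_row_eps i : dual_row (eps i) = row i K.
Proof.
rewrite rowE; congr (_ *m _); apply/rowP => j; rewrite !mxE eps_dual eqxx /= eq_sym.
by case: eqP.
Qed.

Lemma wedge_homog (v : {ffun 'I_L -> dual_forms N}) : \det (rows_mx dual_row v) \is L.-homog.
Proof.
rewrite -[X in X.-homog]muln1; apply: homog_det => a j.
rewrite mxE dual_rowE; apply: rpred_sum => i _; rewrite mul_mpolyC.
by apply/dhomogZ/coefA_homog.
Qed.

Definition wedge_form v : dhomog r.+1 int L := DHomog (wedge_homog v).

Lemma wedge_form_updD (v : {ffun 'I_L -> dual_forms N}) i phi phi' :
  wedge_form (upd v i (phi + phi')) = wedge_form (upd v i phi) + wedge_form (upd v i phi').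
Proof. exact/val_inj/(det_rows_updD dual_rowD). Qed.

Lemma wedge_form_alt (v : {ffun 'I_L -> dual_forms N}) i j : i != j -> v i = v j -> wedge_form v = 0.
Proof. by move=> i_j v_ij; apply/val_inj/(det_rows_alt _ i_j v_ij). Qed.

Lemma wedge_form_compat x : ext_rel x -> fext wedge_form x = 0.
Proof.
case=> [v i phi phi'|v i j i_j v_ij]; last by rewrite fextU (wedge_form_alt i_j v_ij).
by rewrite !raddfB /= !fextU wedge_form_updD addrAC addrK subrr.
Qed.

Definition minor_map : {additive ext_power L (dual_forms N) -> dhomog r.+1 int L} :=
  pres_lift wedge_form_compat.

Lemma minor_map_eps (i : 'I_L -> 'I_N.+1) :
  minor_map (wedge (fun a => eps (i a))) = \det (rowsub i K) :> {mpoly int[r.+1]}.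
Proof.
rewrite /minor_map /wedge pres_liftE /=; congr (\det _).
by apply/row_matrixP => a; rewrite rowK ffunE dual_row_eps; apply/rowP => j; rewrite !mxE.
Qed.

(** * Row sets against monomials, and the conclusion for the minor map *)

Hypothesis hrN : (r <= N)%N.
Hypothesis hL : L = (N - r + 1)%N.

Definition exponent := {t : L.-tuple 'I_r.+1 | t \in basis r.+1 L}.
Implicit Type t : exponent.

Definition exponent_mnm t : 'X_{1..r.+1} := s2m (val t).

(** The classical shift from multisets to subsets: adding a to the a-th entry turns weakly
    increasing tuples in [0, r] into strictly increasing ones in [0, N]. As a <= L - 1 = N - r,
    [inord] never meets its default value. *)
Definition exponent_rows t (a : 'I_L) : 'I_N.+1 := inord (tnth (val t) a + a).

Lemma exponent_rowsE t a : exponent_rows t a = (tnth (val t) a + a)%N :> nat.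
Proof.
by rewrite inordK //; have := ltn_ord a; have := ltn_ord (tnth (val t) a); lia.
Qed.

Lemma exponent_rows_incr t : {homo exponent_rows t : a b / (a < b)%N}.
Proof.
move=> a b lt_ab; rewrite !exponent_rowsE -addnS leq_add //.
exact: (basisP _ (valP t)).
Qed.

Lemma exponent_rows_surj (f : 'I_L -> 'I_N.+1) :
  {homo f : a b / (a < b)%N} -> exists t, exponent_rows t =1 f.
Proof.
move=> f_incr; have f_bounds := increasing_bounds f_incr.
pose u := [tuple (inord (f a - a) : 'I_r.+1) | a < L].
have uE a : tnth u a = (f a - a)%N :> nat.
  by rewrite tnth_mktuple inordK //; have := f_bounds a; have := ltn_ord a; lia.
have u_basis : u \in basis r.+1 L.
  apply/basisP => a b lt_ab.
  by rewrite !uE; have := increasing_gap f_incr (ltnW lt_ab); have := f_bounds a; lia.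
exists (exist _ u u_basis) => a; apply/val_inj; rewrite /= exponent_rowsE /= uE subnK //.
by have /andP[] := f_bounds a.
Qed.

Lemma exponent_mnm_inj : injective exponent_mnm.
Proof. by move=> t t' tt'; apply/val_inj/inj_s2m => //; apply: valP. Qed.

Lemma exponent_mnm_surj m : mdeg m = L -> exists t, exponent_mnm t = m.
Proof.
move=> /eqP; rewrite basis_cover => /mapP[u]; rewrite mem_enum => u_basis ->.
by exists (exist _ u u_basis).
Qed.

Definition minor_term t (s : 'S_L) : {mpoly int[r.+1]} :=
  \prod_a coefA r ((exponent_rows t a : nat)%:Z - (s a : nat)%:Z).

Lemma minor_term1 t : minor_term t 1 = 'X_[exponent_mnm t].
Proof.
rewrite /minor_term (eq_bigr (fun a => 'X_(tnth (val t) a))) => [|a _]; last first.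
  rewrite perm1 exponent_rowsE PoszD addrK /= -ltnS ltn_ord.
  by congr 'X_[U_(_)]; apply/val_inj; rewrite /= inordK.
rewrite mprodXE; congr 'X_[_]; apply/mnmP => i.
rewrite mnm_sumE mnmE -sum1_count big_tuple [RHS]big_mkcond; apply: eq_bigr => a _.
by rewrite mnm1E /=; case: (_ == i).
Qed.

Lemma minor_term_sqwgt t s :
  minor_term t s \is
    (\sum_a `|(exponent_rows t a : nat)%:Z - (s a : nat)%:Z| ^ 2)%N.-homog for @sqwgt _.
Proof. by apply: homog_bigprod => a; apply: coefA_sqwgt. Qed.

(** Every non-identity Leibniz term is homogeneous of weight greater than that of the diagonal
    monomial, so up to that weight only the diagonal term contributes. This supplies both
    unitriangularity conditions. *)
Lemma mcoeff_minor t m : (sqwgt m <= sqwgt (exponent_mnm t))%N ->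
  (\det (rowsub (exponent_rows t) K))@_m = (exponent_mnm t == m)%:R.
Proof.
move=> le_m; rewrite /determinant (bigD1 1%g) //= odd_perm1 mul1r.
have termE (s : 'S_L) : \prod_a rowsub (exponent_rows t) K a (s a) = minor_term t s.
  by apply: eq_bigr => a _; rewrite !mxE.
rewrite mcoeffD termE minor_term1 mcoeffX raddf_sum big1 ?addr0 // => s s_neq1.
rewrite termE mulr_sign /= -[minor_term t s]mulr1.
have term0 : (minor_term t s)@_m = 0.
  apply: (dhomog_nemf_coeff (minor_term_sqwgt t s)); rewrite neq_ltn.
  have := displacement_minimal (@exponent_rows_incr t) s_neq1.
  move=> lt_disp; rewrite (leq_ltn_trans le_m) //.
  (* The diagonal monomial is the identity term, so its weight is the displacement of the
     identity. *)
  by have := minor_term_sqwgt t 1; rewrite minor_term1 dhomogX => /eqP /= ->.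
by rewrite mulr1; case: ifP; rewrite ?mcoeffN term0 ?oppr0.
Qed.

Definition wedge_rows t : ext_power L (dual_forms N) :=
  wedge (fun a => eps (exponent_rows t a)).

Lemma minor_forms_basis : bijective (int_comb (minor_map \o wedge_rows)).
Proof.
apply: (unitriangular_bij (w := @sqwgt _) exponent_mnm_inj exponent_mnm_surj) => t.
  by rewrite /= minor_map_eps mcoeff_minor ?eqxx.
move=> m; rewrite /= minor_map_eps; case: ltnP => [|le_m]; first by right.
by rewrite mcoeff_minor //; case: (exponent_mnm t =P m) => [<-|]; [left | rewrite eqxx].
Qed.

Lemma wedge_rows_ind (P : ext_power L (dual_forms N) -> Prop) :
  P 0 -> (forall u u', P u -> P u' -> P (u - u')) -> (forall t, P (wedge_rows t)) ->
  forall u, P u.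
Proof.
move=> P0 PB Pt; apply: (ext_power_basis_ind (@eps_span N)) => // f f_incr.
have [t tE] := exponent_rows_surj f_incr.
suff -> : wedge (@eps N \o f) = wedge_rows t by [].
by congr (pgen _ _); apply/ffunP => a; rewrite !ffunE /= tE.
Qed.

(** Independence is pulled back along [minor_map] from the independence of the minors; generation is
    [wedge_rows_ind]. *)
Lemma wedge_rows_basis : bijective (int_comb wedge_rows).
Proof.
apply: bijectiveP.
  move=> c d /(congr1 (fun u => minor_map u)); rewrite /= !raddf_int_comb.
  exact: (bij_inj minor_forms_basis).
apply: wedge_rows_ind => [|u u' [c <-] [c' <-]|t]; first by exists 0; rewrite raddf0.
  by exists (c - c'); rewrite raddfB.
by exists [ffun t' => (t' == t)%:R]; rewrite int_comb_delta.
Qed.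

Lemma minor_map_bij : bijective minor_map.
Proof.
have [g gK Kg] := wedge_rows_basis.
(* [minor_map] takes coordinates in the wedge basis, then combines the minors with them. *)
apply: (eq_bij (bij_comp minor_forms_basis (Bijective Kg gK))) => u.
by rewrite /= -raddf_int_comb Kg.
Qed.

End MinorMap.

Theorem proposition3p4 (N r L : nat) (hr : (1 <= r)%N) (hrN : (r <= N)%N)
    (hL : L = (N - r + 1)%N) :
  exists Psi : {additive ext_power L (dual_forms N) -> dhomog r.+1 int L},
    [/\ is_maximal_minor_map Psi,
        (forall Psi' : {additive ext_power L (dual_forms N) -> dhomog r.+1 int L},
           is_maximal_minor_map Psi' -> Psi' =1 Psi),
        free_of_finite_rank (ext_power L (dual_forms N))
          /\ free_of_finite_rank (dhomog r.+1 int L),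
        bijective Psi
      & forall R : pzRingType, bijective (base_change_map R Psi)].
Proof.
exists (minor_map N r L); have Psi_bij := minor_map_bij hrN hL; split => //.
- by move=> i _; apply: minor_map_eps.
(* Two additive maps that agree on the generating increasing wedges are equal. *)
- move=> Psi' Psi'P; apply: (wedge_rows_ind hrN hL) => [|u u' IHu IHu'|t].
  + by rewrite !raddf0.
  + by rewrite !raddfB IHu IHu'.
  apply/val_inj; rewrite /= (Psi'P _ (@exponent_rows_incr _ _ _ hrN hL t)).
  by rewrite minor_map_eps.
- split; first exact: free_of_int_comb (wedge_rows_basis hrN hL).
  exact: free_of_int_comb (minor_forms_basis hrN hL).
by move=> R; apply: base_change_map_bij.
Qed.
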